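(* Let $A$ be a $b\times b$ integer matrix none of whose eigenvalues is a root of unity, and let $\Phi_A:\mathbb{T}^b\to\mathbb{T}^b$ be the toral endomorphism induced by $A$ on $\mathbb{T}^b=\mathbb{R}^b/\mathbb{Z}^b$. Then the set of periodic points $F_\infty=\bigcup_{i\ge 1}\mathrm{Fix}(\Phi_A^i)$ is a subgroup of $\mathbb{T}^b$, and it is naturally identified with the group $\mathrm{BF}_\infty(A)$ of possible displacements of $\Phi_A$: the map $$\Psi:\mathrm{BF}_\infty(A)\to\mathbb{T}^b,\qquad \Psi([\vec n+\Gamma_i])=(A^i-I)^{-1}\vec n+\mathbb{Z}^b,$$ is a well-defined injective group homomorphism with image $F_\infty$. The identification is that of a fixed point of $\Phi_A^i$ with its displacement: if $y\in\mathrm{Fix}(\Phi_A^i)$ then $\Psi([D_i(y)])=y$.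
   Context: For $i\ge 1$ put $\Gamma_i=(A^i-I)\mathbb{Z}^b$ and $\mathrm{BF}_i(A)=\mathbb{Z}^b/\Gamma_i$. The positive integers are directed by divisibility. When $i\mid j$ let $C_{ij}=A^{(\frac ji-1)i}+A^{(\frac ji-2)i}+\dots+A^i+I$, so that $A^j-I=C_{ij}(A^i-I)$, and let $\Upsilon_{ij}:\mathrm{BF}_i(A)\to\mathrm{BF}_j(A)$ be the homomorphism $\vec n+\Gamma_i\mapsto C_{ij}\vec n+\Gamma_j$. These form a directed system of abelian groups, and $\mathrm{BF}_\infty(A)=\varinjlim \mathrm{BF}_i(A)$ is its direct limit; $[g]$ denotes the class in $\mathrm{BF}_\infty(A)$ of $g\in \mathrm{BF}_i(A)$. Displacements for $\Phi_A$ are computed with the lift $A:\mathbb{R}^b\to\mathbb{R}^b$ of $\Phi_A$: if $y\in\mathrm{Fix}(\Phi_A^i)$ and $\tilde y\in\mathbb{R}^b$ is a lift of $y$, then $A^i\tilde y=\tilde y+\vec n$ for some $\vec n\in\mathbb{Z}^b$, and the displacement of $y$ is $D_i(y)=\vec n+\Gamma_i\in\mathrm{BF}_i(A)$ (independent of the choice of $\tilde y$). *)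

(* Defs.v *)
From HB Require Import structures.
From mathcomp Require Import all_boot all_order all_algebra.
From mathcomp Require Import generic_quotient ring_quotient.
From mathcomp Require Import complex.
From mathcomp Require Import all_classical all_reals.

Set Implicit Arguments.
Unset Strict Implicit.
Unset Printing Implicit Defensive.

Import Order.TTheory GRing.Theory Num.Theory.
Import Quotient.Exports.

Local Open Scope classical_set_scope.
Local Open Scope ring_scope.
Local Open Scope quotient_scope.

Definition posnat := {i : nat | (0 < i)%N}.

Lemma lcm_posnat_subproof (i j : posnat) : (0 < lcmn (val i) (val j))%N.
Proof. by rewrite lcmn_gt0 (valP i) (valP j). Qed.

Definition lcm_posnat (i j : posnat) : posnat :=
  exist _ (lcmn (val i) (val j)) (lcm_posnat_subproof i j).

(* Directed systems of abelian groups indexed by the positive integers, which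
   are directed by divisibility; lcm_posnat provides the upper bounds. *)
Record dirsys := DirSys {
  ds_obj :> posnat -> zmodType;
  ds_map : forall i j : posnat, (val i %| val j)%N ->
    {additive ds_obj i -> ds_obj j};
  ds_map_id : forall i (hii : (val i %| val i)%N) x, ds_map hii x = x;
  ds_map_comp : forall i j k (hij : (val i %| val j)%N)
      (hjk : (val j %| val k)%N) (hik : (val i %| val k)%N) x,
    ds_map hjk (ds_map hij x) = ds_map hik x
}.

(* The direct limit is the disjoint union of the groups modulo the relation
   identifying two elements with a common image further along the system. *)
Section DirectLimit.
Variable G : dirsys.

Definition dsum := {i : posnat & G i}.

Definition dl_rel (u v : dsum) : bool :=
  `[< exists k (hu : (val (tag u) %| val k)%N) (hv : (val (tag v) %| val k)%N),
        ds_map G hu (tagged u) = ds_map G hv (tagged v) >].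

Lemma dl_rel_equiv : equiv_class_of dl_rel.
Proof.
split.
- by move=> [i x]; apply/asboolP; exists i, (dvdnn _), (dvdnn _).
- by move=> u v; apply/asboolP/asboolP => -[k [hu [hv e]]]; exists k, hv, hu.
- move=> v u w /asboolP[k [hu [hv e1]]] /asboolP[l [hv' [hw e2]]].
  have hk : (val k %| val (lcm_posnat k l))%N by exact: dvdn_lcml.
  have hl : (val l %| val (lcm_posnat k l))%N by exact: dvdn_lcmr.
  apply/asboolP; exists (lcm_posnat k l).
  exists (dvdn_trans hu hk), (dvdn_trans hw hl).
  rewrite -(ds_map_comp hu hk) e1 (ds_map_comp hv hk (dvdn_trans hv hk)).
  by rewrite -(ds_map_comp hv' hl) e2 (ds_map_comp hw hl (dvdn_trans hw hl)).
Qed.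

Canonical dl_equiv := EquivRelPack dl_rel_equiv.
Canonical dl_encModRel := defaultEncModRel dl_rel.

Definition dirlim := {eq_quot dl_rel}.
HB.instance Definition _ : EqQuotient dsum dl_rel dirlim := EqQuotient.on dirlim.
HB.instance Definition _ := Choice.on dirlim.

Definition dl_class (i : posnat) (x : G i) : dirlim :=
  \pi_dirlim (Tagged (fun i => G i : Type) x : dsum).

Lemma dl_classE (i j : posnat) (x : G i) (y : G j) :
  dl_class x = dl_class y <->
  exists k (hi : (val i %| val k)%N) (hj : (val j %| val k)%N),
    ds_map G hi x = ds_map G hj y.
Proof.
split=> [/eqmodP/asboolP //|H]; apply/eqmodP/asboolP; exact: H.
Qed.

Lemma dl_class_map (i j : posnat) (h : (val i %| val j)%N) (x : G i) :
  dl_class (ds_map G h x) = dl_class x.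
Proof.
apply/dl_classE; exists j, (dvdnn _), h; exact: ds_map_id.
Qed.

Lemma dl_class_surj (z : dirlim) : exists i (x : G i), z = dl_class x.
Proof. by elim/quotW: z => -[i x]; exists i, x. Qed.

Definition dsum_add (u v : dsum) : dsum :=
  let k := lcm_posnat (tag u) (tag v) in
  Tagged (fun i => G i : Type)
    (ds_map G (dvdn_lcml _ _ : (val (tag u) %| val k)%N) (tagged u)
     + ds_map G (dvdn_lcmr _ _ : (val (tag v) %| val k)%N) (tagged v)).

Definition dsum_opp (u : dsum) : dsum :=
  Tagged (fun i => G i : Type) (- tagged u).

Definition dl_one : posnat := exist _ 1%N (ltn0Sn 0).

Definition dl_zero : dirlim := dl_class (0 : G dl_one).
Definition dl_opp (z : dirlim) : dirlim := \pi_dirlim (dsum_opp (repr z)).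
Definition dl_add (z w : dirlim) : dirlim :=
  \pi_dirlim (dsum_add (repr z) (repr w)).

Lemma dl_class_repr (z : dirlim) : z = dl_class (tagged (repr z)).
Proof. by rewrite /dl_class; case: (repr z) (reprK z) => i x /= <-. Qed.

Lemma dl_oppE (i : posnat) (x : G i) : dl_opp (dl_class x) = dl_class (- x).
Proof.
have /dl_classE[k [h1 [h2 e]]] := dl_class_repr (dl_class x).
by apply/dl_classE; exists k, h2, h1; rewrite !raddfN e.
Qed.

Lemma dl_addE (i : posnat) (x y : G i) :
  dl_add (dl_class x) (dl_class y) = dl_class (x + y).
Proof.
have /dl_classE[k [h1 [h2 e1]]] := dl_class_repr (dl_class x).
have /dl_classE[l [h3 [h4 e2]]] := dl_class_repr (dl_class y).
set m := lcm_posnat k l.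
have hk : (val k %| val m)%N by exact: dvdn_lcml.
have hl : (val l %| val m)%N by exact: dvdn_lcmr.
set u := repr (dl_class x) in h2 e1 *; set v := repr (dl_class y) in h4 e2 *.
have huv : (val (lcm_posnat (tag u) (tag v)) %| val m)%N.
  by rewrite /= dvdn_lcm (dvdn_trans h2 hk) (dvdn_trans h4 hl).
apply/dl_classE; exists m, huv, (dvdn_trans h1 hk).
rewrite !raddfD /= (ds_map_comp _ huv (dvdn_trans h2 hk)).
rewrite (ds_map_comp _ huv (dvdn_trans h4 hl)).
rewrite -(ds_map_comp h2 hk) -e1 (ds_map_comp h1 hk (dvdn_trans h1 hk)).
rewrite -(ds_map_comp h4 hl) -e2.
by rewrite (ds_map_comp h3 hl (dvdn_trans h1 hk)).
Qed.

Lemma dl_class0 (i : posnat) : dl_class (0 : G i) = dl_zero.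
Proof.
apply/dl_classE; exists i, (dvdnn _), (dvd1n _).
by rewrite !raddf0.
Qed.

Lemma dl_common (z w : dirlim) :
  exists i (x y : G i), z = dl_class x /\ w = dl_class y.
Proof.
have [i [x ->]] := dl_class_surj z; have [j [y ->]] := dl_class_surj w.
have hi : (val i %| val (lcm_posnat i j))%N by exact: dvdn_lcml.
have hj : (val j %| val (lcm_posnat i j))%N by exact: dvdn_lcmr.
by exists (lcm_posnat i j), (ds_map G hi x), (ds_map G hj y);
  rewrite !dl_class_map.
Qed.

Lemma dl_addA : associative dl_add.
Proof.
move=> z w t; have [i [x [y [-> ->]]]] := dl_common z w.
have [j [c ->]] := dl_class_surj t.
have hi : (val i %| val (lcm_posnat i j))%N by exact: dvdn_lcml.
have hj : (val j %| val (lcm_posnat i j))%N by exact: dvdn_lcmr.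
rewrite -(dl_class_map hi x) -(dl_class_map hi y) -(dl_class_map hj c).
by rewrite !dl_addE addrA.
Qed.

Lemma dl_addC : commutative dl_add.
Proof.
by move=> z w; have [i [x [y [-> ->]]]] := dl_common z w; rewrite !dl_addE addrC.
Qed.

Lemma dl_add0 : left_id dl_zero dl_add.
Proof.
by move=> z; have [i [x ->]] := dl_class_surj z; rewrite -(dl_class0 i) dl_addE add0r.
Qed.

Lemma dl_addN : left_inverse dl_zero dl_opp dl_add.
Proof.
move=> z; have [i [x ->]] := dl_class_surj z.
by rewrite dl_oppE dl_addE addNr dl_class0.
Qed.

HB.instance Definition _ :=
  GRing.isZmodule.Build dirlim dl_addA dl_addC dl_add0 dl_addN.

Lemma dl_class_is_zmod_morphism (i : posnat) : zmod_morphism (@dl_class i).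
Proof. by move=> x y; rewrite -dl_addE -dl_oppE. Qed.

HB.instance Definition _ (i : posnat) :=
  GRing.isZmodMorphism.Build (G i) dirlim (@dl_class i)
    (@dl_class_is_zmod_morphism i).

End DirectLimit.

Section BowenFranks.
Variables (b : nat) (A : 'M[int]_b).

Definition Gamma (i : nat) : {pred 'cV[int]_b} :=
  fun n => `[< exists m : 'cV[int]_b, n = (A ^+ i - 1%:M) *m m >].

Lemma Gamma_zmod_closed i : zmod_closed (Gamma i).
Proof.
split; first by apply/asboolP; exists 0; rewrite mulmx0.
move=> _ _ /asboolP[m ->] /asboolP[n ->].
by apply/asboolP; exists (m - n); rewrite mulmxBr.
Qed.

HB.instance Definition _ i :=
  GRing.isZmodClosed.Build 'cV[int]_b (Gamma i) (Gamma_zmod_closed i).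

Definition BF (i : nat) := Quotient.quot (Gamma i).
HB.instance Definition _ i := GRing.Zmodule.on (BF i).
HB.instance Definition _ i := EqQuotient.on (BF i).

Definition BFclass (i : nat) (n : 'cV[int]_b) : BF i := \pi n.

Lemma BFclassE i n m : BFclass i n = BFclass i m <-> n - m \in Gamma i.
Proof.
by rewrite (Quotient.idealrBE (Gamma i)); split=> /eqP.
Qed.

Lemma BFclass_is_zmod_morphism i : zmod_morphism (BFclass i).
Proof. exact: raddfB. Qed.

HB.instance Definition _ i :=
  GRing.isZmodMorphism.Build 'cV[int]_b (BF i) (BFclass i)
    (@BFclass_is_zmod_morphism i).

Lemma BFclass_repr i (x : BF i) : BFclass i (repr x) = x.
Proof. exact: reprK. Qed.

Definition Cmx (i j : nat) : 'M[int]_b := \sum_(k < j %/ i) A ^+ (k * i).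

Lemma CmxE i j : (i %| j)%N -> A ^+ j - 1%:M = Cmx i j *m (A ^+ i - 1%:M).
Proof.
move=> /divnK {1}<-; rewrite mulnC exprM.
have -> : A ^+ i ^+ (j %/ i) - 1%:M = (A ^+ i - 1%:M) *m Cmx i j.
  rewrite [LHS]subrX1; congr (_ *m _); apply: eq_bigr => k _.
  by rewrite mulnC exprM.
rewrite mulmxBl mulmxBr mul1mx mulmx1; congr (_ - _).
rewrite mulmx_sumr mulmx_suml; apply: eq_bigr => k _.
by rewrite -[LHS]exprD -[RHS]exprD addnC.
Qed.

(* Meaningful only when i %| j: see UpsilonE for the action on classes and
   independence of the representative. *)
Definition Upsilon (i j : nat) (x : BF i) : BF j :=
  BFclass j (Cmx i j *m repr x).

Lemma UpsilonE i j n : (i %| j)%N ->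
  Upsilon j (BFclass i n) = BFclass j (Cmx i j *m n).
Proof.
move=> dij; apply/BFclassE.
have /BFclassE/asboolP[m e] := BFclass_repr (BFclass i n).
by apply/asboolP; exists m; rewrite -mulmxBr e mulmxA -CmxE.
Qed.

Lemma Upsilon_is_zmod_morphism i j : (i %| j)%N ->
  zmod_morphism (@Upsilon i j).
Proof.
move=> dij x y; rewrite -[x]BFclass_repr -[y]BFclass_repr -raddfB.
by rewrite !UpsilonE // mulmxBr raddfB.
Qed.

Definition Upsilon_additive (i j : posnat) (dij : (val i %| val j)%N) :
    {additive BF (val i) -> BF (val j)} :=
  HB.pack (@Upsilon (val i) (val j))
    (GRing.isZmodMorphism.Build _ _ _ (Upsilon_is_zmod_morphism dij)).

Lemma Upsilon_id (i : posnat) (dii : (val i %| val i)%N) x :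
  Upsilon_additive dii x = x.
Proof.
rewrite -[x]BFclass_repr /= UpsilonE // /Cmx divnn (valP i) big_ord1 mul0n.
by rewrite mul1mx.
Qed.

Lemma Cmx_comp i j k : (0 < i)%N -> (0 < j)%N -> (i %| j)%N -> (j %| k)%N ->
  Cmx i k = Cmx j k *m Cmx i j.
Proof.
move=> i0 j0 dij djk; rewrite /Cmx.
have -> : (k %/ i = k %/ j * (j %/ i))%N.
  by rewrite -{1}(divnK djk) muln_divA.
have -> : \sum_(c < k %/ j) A ^+ (c * j)
        = \sum_(c < k %/ j) A ^+ (c * (j %/ i) * i).
  by apply: eq_bigr => c _; rewrite -mulnA divnK.
elim: (k %/ j)%N => [|q IHq]; first by rewrite mul0n !big_ord0 mul0mx.
rewrite mulSnr big_split_ord /= IHq big_ord_recr mulmxDl; congr (_ + _).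
rewrite mulmx_sumr; apply: eq_bigr => d _.
by rewrite mulnDl exprD.
Qed.

Lemma Upsilon_comp (i j k : posnat) (dij : (val i %| val j)%N)
    (djk : (val j %| val k)%N) (dik : (val i %| val k)%N) x :
  Upsilon_additive djk (Upsilon_additive dij x) = Upsilon_additive dik x.
Proof.
rewrite -[x]BFclass_repr /= !UpsilonE // mulmxA.
by rewrite (Cmx_comp (valP i) (valP j) dij djk).
Qed.

Definition BF_system : dirsys :=
  @DirSys (fun i => BF (val i)) Upsilon_additive Upsilon_id Upsilon_comp.

Definition BF_infty : zmodType := dirlim BF_system.

Definition BF_infty_class (i : posnat) (g : BF (val i)) : BF_infty :=
  dl_class (g : BF_system i).

End BowenFranks.

Section Torus.
Variables (R : realType) (b : nat).

Definition mxR (m n : nat) (M : 'M[int]_(m, n)) : 'M[R]_(m, n) :=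
  map_mx intr M.

Definition intlattice : {pred 'cV[R]_b} :=
  fun x => `[< exists n : 'cV[int]_b, x = mxR n >].

Lemma intlattice_zmod_closed : zmod_closed intlattice.
Proof.
split; first by apply/asboolP; exists 0; rewrite /mxR map_mx0.
move=> _ _ /asboolP[m ->] /asboolP[n ->].
by apply/asboolP; exists (m - n); rewrite /mxR map_mxB.
Qed.

HB.instance Definition _ :=
  GRing.isZmodClosed.Build 'cV[R]_b intlattice intlattice_zmod_closed.

Definition torus := Quotient.quot intlattice.
HB.instance Definition _ := GRing.Zmodule.on torus.
HB.instance Definition _ := EqQuotient.on torus.

Definition to_torus (x : 'cV[R]_b) : torus := \pi x.

Lemma to_torus_is_zmod_morphism : zmod_morphism to_torus.
Proof. exact: raddfB. Qed.

HB.instance Definition _ :=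
  GRing.isZmodMorphism.Build 'cV[R]_b torus to_torus to_torus_is_zmod_morphism.

Lemma to_torusE (x y : 'cV[R]_b) :
  to_torus x = to_torus y <-> exists n : 'cV[int]_b, x = y + mxR n.
Proof.
have -> : (to_torus x = to_torus y) <-> x - y \in intlattice.
  by rewrite (Quotient.idealrBE intlattice); split=> /eqP.
split=> [/asboolP[n e]|[n ->]].
  by exists n; rewrite -e addrC subrK.
by apply/asboolP; exists n; rewrite addrC addKr.
Qed.

Lemma to_torus_repr (y : torus) : to_torus (repr y) = y.
Proof. exact: reprK. Qed.

Variable A : 'M[int]_b.

(* PhiE: this is the map induced on the quotient by x |-> A x. *)
Definition Phi (y : torus) : torus := to_torus (mxR A *m repr y).

Lemma PhiE x : Phi (to_torus x) = to_torus (mxR A *m x).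
Proof.
rewrite /Phi; have /to_torusE[n ->] := to_torus_repr (to_torus x).
by apply/to_torusE; exists (A *m n); rewrite mulmxDr [mxR (A *m n)]map_mxM.
Qed.

Definition Fix (i : nat) : set torus := [set y | iter i Phi y = y].

Definition F_infty : set torus := \bigcup_(i in [set i | (0 < i)%N]) Fix i.

(* Meaningful on Fix i, where A^i y~ - y~ is integral for every lift y~ of y;
   displacementE shows independence of the lift. xget returns the (unique)
   element of the set, and the junk value 0 if it is empty. *)
Definition displacement (i : nat) (y : torus) : BF A i :=
  BFclass A i
    (xget 0 [set n : 'cV[int]_b | mxR (A ^+ i) *m repr y = repr y + mxR n]).

Lemma displacementE (i : nat) (x : 'cV[R]_b) (n : 'cV[int]_b) :
  mxR (A ^+ i) *m x = x + mxR n -> displacement i (to_torus x) = BFclass A i n.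
Proof.
move=> e; rewrite /displacement.
have /to_torusE[m ->] := to_torus_repr (to_torus x).
have mxR_inj : injective (@mxR b 1).
  move=> u v /matrixP h; apply/matrixP => k l.
  by have := h k l; rewrite !mxE => /intr_inj.
have eq_mn : mxR (A ^+ i) *m (x + mxR m)
           = x + mxR m + mxR (n + (A ^+ i - 1%:M) *m m).
  rewrite mulmxDr e mulmxBl mul1mx /mxR !map_mxD !map_mxN map_mxM.
  by rewrite -!addrA; congr (_ + _); rewrite [RHS]addrCA [X in _ = _ + X]addrC subrK.
apply/BFclassE; case: xgetP => [k _ /= |/(_ _ eq_mn)//].
rewrite eq_mn => /addrI/mxR_inj <-.
by apply/asboolP; exists m; rewrite addrC addKr.
Qed.

End Torus.

Arguments mxR R {m n} M.
Arguments F_infty R {b} A.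

(* Main.v *)
(* If no eigenvalue of A is a root of unity then A^i - I is invertible over the
   reals, since X^i - 1 splits into factors X - z with z^i = 1. A point x + Z^b
   is fixed by the i-th iterate exactly when (A^i - I) x = n is integral, so
   n |-> (A^i - I)^-1 n identifies BF_i(A) with Fix(Phi_A^i), with inverse the
   displacement. As A^j - I = C_ij (A^i - I), these identifications are
   compatible with the maps of the system and pass to the direct limit, where
   they remain injective. *)
Require Import Defs.
From HB Require Import structures.
From mathcomp Require Import all_boot all_order all_algebra.
From mathcomp Require Import complex.
From mathcomp Require Import all_classical all_reals.

Set Implicit Arguments.
Unset Strict Implicit.
Unset Printing Implicit Defensive.

Import Order.TTheory GRing.Theory Num.Theory.

Local Open Scope classical_set_scope.
Local Open Scope ring_scope.
Local Open Scope complex_scope.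

Lemma unitmx_exp_sub1 (F : closedFieldType) (b : nat) (M : 'M[F]_b) (i : nat) :
  (0 < i)%N ->
  (forall z, eigenvalue M z -> ~~ i.-unity_root z) ->
  M ^+ i - 1%:M \in unitmx.
Proof.
(* The empty matrix has determinant 1; in positive size [horner_mx] evaluates polynomials at [M]. *)
case: b M => [|b] M i_gt0 hM; first by rewrite unitmxE det_mx00 unitr1.
have [r Dr] := closed_field_poly_normal ('X^i - 1 : {poly F}).
rewrite (lead_coefXnsubC 1 i_gt0) scale1r in Dr.
have -> : M ^+ i - 1%:M = \prod_(z <- r) (M - z%:M).
  have <- : horner_mx M ('X^i - 1) = M ^+ i - 1%:M.
    by rewrite rmorphB rmorphXn /= horner_mx_X rmorph1.
  rewrite Dr rmorph_prod; apply: eq_bigr => z _.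
  by rewrite rmorphB /= horner_mx_X horner_mx_C.
rewrite big_seq; elim/big_ind: _ => [|P Q P_unit Q_unit|z rz].
- exact: unitmx1.
- by rewrite unitmx_mul P_unit.
(* A singular factor has a nonzero kernel, which is the eigenspace of [M] for [z]; but every [z] in
   [r] is an i-th root of unity. *)
- rewrite -row_free_unit -kermx_eq0; apply/negPn/negP => /hM.
  by rewrite /root_of_unity Dr root_prod_XsubC rz.
Qed.

(** Equivalent elements have a common image further along, where the compatible maps [f] agree, so
    evaluating at the chosen representative loses nothing. Additivity is checked at an index common
    to both arguments. *)
Lemma dirlim_universal (G : dirsys) (H : zmodType)
    (f : forall i, {additive G i -> H}) :
  (forall i j (h : (val i %| val j)%N) x, f j (ds_map G h x) = f i x) ->
  exists g : {additive dirlim G -> H}, forall i x, g (@dl_class G i x) = f i x.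
Proof.
move=> fG; pose g (z : dirlim G) := f _ (tagged (repr z)).
have gE i x : g (@dl_class G i x) = f i x.
  have /dl_classE[k [h1 [h2 e]]] := dl_class_repr (@dl_class G i x).
  by rewrite /g -(fG _ _ h2) -e fG.
have g_zmod : zmod_morphism g.
  move=> z w; have [i [x [y [-> ->]]]] := dl_common z w.
  by rewrite -raddfB !gE raddfB.
pose gA : {additive dirlim G -> H} :=
  HB.pack g (GRing.isZmodMorphism.Build _ _ g g_zmod).
by exists gA.
Qed.

Lemma dirlim_injective (G : dirsys) (H : Type) (g : dirlim G -> H) :
  (forall i, injective (fun x => g (@dl_class G i x))) -> injective g.
Proof.
move=> g_inj z w; have [i [x [y [-> ->]]]] := dl_common z w.
by move=> /g_inj ->.
Qed.

Section PeriodicPoints.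
Variables (R : realType) (b : nat) (A : 'M[int]_b).

Lemma iter_Phi i (x : 'cV[R]_b) :
  iter i (Phi A) (to_torus x) = to_torus (mxR R (A ^+ i) *m x).
Proof.
elim: i => [|i IHi]; first by rewrite expr0 /mxR map_mx1 mul1mx.
by rewrite iterS IHi PhiE exprS /mxR map_mxM mulmxA.
Qed.

Lemma mxR_inj m n : injective (@mxR R m n).
Proof.
by move=> M N /matrixP MN; apply/matrixP => k l;
  have := MN k l; rewrite !mxE => /intr_inj.
Qed.

Lemma mxR_exp_sub1 i (x : 'cV[R]_b) :
  mxR R (A ^+ i - 1%:M) *m x = mxR R (A ^+ i) *m x - x.
Proof. by rewrite /mxR map_mxB map_mx1 mulmxBl mul1mx. Qed.

Lemma Fix_displaced i (y : torus R b) : Fix A i y ->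
  exists (x : 'cV[R]_b) (n : 'cV[int]_b),
    y = to_torus x /\ mxR R (A ^+ i) *m x = x + mxR R n.
Proof.
rewrite -(to_torus_repr y) /Fix /= iter_Phi => /to_torusE[n e].
by exists (repr y), n.
Qed.

Section Invertible.
Variable i : nat.
Hypothesis Ai_unit : mxR R (A ^+ i - 1%:M) \in unitmx.

Definition BF_point (x : BF A i) : torus R b :=
  to_torus (invmx (mxR R (A ^+ i - 1%:M)) *m mxR R (repr x)).

(** Changing the representative by (A^i - I) m moves the point by the integral vector m. *)
Lemma BF_point_class n :
  BF_point (BFclass A i n)
  = to_torus (invmx (mxR R (A ^+ i - 1%:M)) *m mxR R n).
Proof.
have /BFclassE/asboolP[m e] := BFclass_repr (BFclass A i n).
apply/to_torusE; exists m; apply/eqP; rewrite [X in _ == X]addrC -subr_eq -mulmxBr.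
by rewrite /mxR -map_mxB e map_mxM mulKmx.
Qed.

Lemma BF_point_is_zmod_morphism : zmod_morphism BF_point.
Proof.
move=> x y; rewrite -[x]BFclass_repr -[y]BFclass_repr -raddfB.
by rewrite !BF_point_class [mxR R (_ - repr y)]map_mxB mulmxBr raddfB.
Qed.

Definition BF_point_additive : {additive BF A i -> torus R b} :=
  HB.pack BF_point
    (GRing.isZmodMorphism.Build _ _ _ BF_point_is_zmod_morphism).

(** If two points differ by an integral m, multiplying by A^i - I shows that the representatives
    differ by (A^i - I) m over the reals, hence over the integers. *)
Lemma BF_point_inj : injective BF_point.
Proof.
move=> x y; rewrite -[x]BFclass_repr -[y]BFclass_repr !BF_point_class.
move=> /to_torusE[m e]; apply/BFclassE/asboolP; exists m; apply: mxR_inj.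
rewrite [RHS]map_mxM [LHS]map_mxB.
by rewrite -[LHS](mulKVmx Ai_unit) mulmxBr e addrAC subrr add0r.
Qed.

Lemma BF_point_Fix x : Fix A i (BF_point x).
Proof.
(* The lift x = (A^i - I)^-1 n satisfies A^i x = x + n, so the witness is n itself. *)
rewrite /Fix /= iter_Phi; apply/to_torusE; exists (repr x).
by apply/eqP; rewrite [X in _ == X]addrC -subr_eq -mxR_exp_sub1 mulKVmx.
Qed.

Lemma BF_point_displacement y : Fix A i y -> BF_point (displacement A i y) = y.
Proof.
move=> /Fix_displaced[x [n [-> e]]]; rewrite (displacementE e) BF_point_class.
congr to_torus; apply: (canLR (mulKmx Ai_unit)).
by rewrite mxR_exp_sub1 e addrC addKr.
Qed.

End Invertible.

Lemma BF_point_Upsilon i j (x : BF A i) : (i %| j)%N ->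
  mxR R (A ^+ i - 1%:M) \in unitmx -> mxR R (A ^+ j - 1%:M) \in unitmx ->
  BF_point (Upsilon j x) = BF_point x.
Proof.
move=> dij ui uj; rewrite -[x]BFclass_repr UpsilonE // !BF_point_class //.
congr to_torus; apply: (canLR (mulKmx uj)); rewrite (CmxE _ dij).
by rewrite /mxR !map_mxM -mulmxA mulKVmx.
Qed.

(** Invertibility passes from the complex to the real matrix because both determinants are images of
    the same integer, and each is a unit exactly when that integer is nonzero. *)
Lemma mxR_exp_sub1_unit i : (0 < i)%N ->
  (forall z : R[i], eigenvalue (map_mx intr A : 'M[R[i]]_b) z ->
     ~~ i.-unity_root z) ->
  mxR R (A ^+ i - 1%:M) \in unitmx.
Proof.
move=> i_gt0 /(unitmx_exp_sub1 i_gt0).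
rewrite -(map_mx1 (intr : int -> R[i])) -rmorphXn -map_mxB.
by rewrite !unitmxE !det_map_mx !unitfE !intr_eq0.
Qed.

End PeriodicPoints.

Theorem theorem5p3 (R : realType) (b : nat) (A : 'M[int]_b)
  (hA : forall z : R[i], eigenvalue (map_mx intr A : 'M[R[i]]_b) z ->
     ~ (exists2 n : nat, (0 < n)%N & n.-unity_root z)) :
  zmod_closed [pred y | y \in F_infty R A] /\
  (forall i : posnat, mxR R (A ^+ val i - 1%:M) \in unitmx) /\
  exists Psi : {additive BF_infty A -> torus R b},
    [/\ (forall (i : posnat) (n : 'cV[int]_b),
           Psi (BF_infty_class (BFclass A (val i) n)) =
           to_torus (invmx (mxR R (A ^+ val i - 1%:M)) *m mxR R n)),
        injective Psi,
        range Psi = F_infty R A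
      & forall (i : posnat) (y : torus R b), Fix A (val i) y ->
          Psi (BF_infty_class (displacement A (val i) y)) = y].
Proof.
have unitA (i : posnat) : mxR R (A ^+ val i - 1%:M) \in unitmx.
  apply: mxR_exp_sub1_unit (valP i) _ => z /hA not_unity.
  by apply/negP => zi; apply: not_unity; exists (val i) => //; apply: valP i.
have [Psi PsiE] := @dirlim_universal (BF_system A) _
  (fun i => BF_point_additive (unitA i))
  (fun i j dij x => BF_point_Upsilon x dij (unitA i) (unitA j)).
have Psi_Fix (i : posnat) y : Fix A (val i) y ->
    Psi (BF_infty_class (displacement A (val i) y)) = y.
  by move=> yi; rewrite /BF_infty_class PsiE; apply: BF_point_displacement.
have PsiF : range Psi = F_infty R A.
  apply/seteqP; split=> [_ [z _ <-]|y [i i_gt0 yi]].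
    have [i [x ->]] := dl_class_surj z; rewrite PsiE.
    by exists (val i); [apply: valP i | apply: BF_point_Fix].
  (* A periodic point is the image of the class of its own displacement. *)
  by exists (BF_infty_class (displacement A (val (exist _ i i_gt0 : posnat)) y));
    rewrite ?Psi_Fix.
split; [|split=> //; exists Psi; split=> //].
(* The periodic points form a subgroup because they are the image of the additive map [Psi]. *)
- split=> [|y z]; rewrite !inE /= -PsiF; first by exists 0; rewrite ?raddf0.
  by move=> [u _ <-] [v _ <-]; exists (u - v); rewrite ?raddfB.
- by move=> i n; rewrite /BF_infty_class PsiE; apply: BF_point_class.
- apply: dirlim_injective => i x y; rewrite !PsiE.
  exact: (BF_point_inj (unitA i)).
Qed.
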